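(* For every integer $n\ge 2$, let $P_n$ be the path graph with vertex set $\{1,\dots,n\}$ and edges $\{i,i+1\}$, $1\le i\le n-1$. Then \[ \mathrm{QEC}(P_n)=\frac{-1}{1+\cos(\pi/n)}. \] Consequently, if $n$ is even then $\lambda_2(P_n)=\mathrm{QEC}(P_n)$, and if $n$ is odd then $\lambda_2(P_n)<\mathrm{QEC}(P_n)$.
   Context: For a connected graph $G=(V,E)$ with graph distance $d(x,y)$ (length of a shortest walk from $x$ to $y$), the quadratic embedding constant is \[ \mathrm{QEC}(G)=\sup\Big\{\sum_{x,y\in V} d(x,y)f(x)f(y) : f\in\mathcal{F}_{0,1}(V)\Big\}, \] where $\mathcal{F}_{0,1}(V)$ is the set of finitely supported $f:V\to\mathbb{R}$ with $\sum_x f(x)=0$ and $\sum_x f(x)^2=1$. For a finite graph $G$, $\lambda_1(G)\ge\lambda_2(G)\ge\dots$ denote the eigenvalues of the distance matrix $(d(x,y))_{x,y\in V}$, listed with multiplicity in nonincreasing order. *)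

(* Defs.v *)
From HB Require Import structures.
From mathcomp Require Import all_boot all_order all_algebra.
From mathcomp Require Import all_classical all_reals all_analysis.

Set Implicit Arguments.
Unset Strict Implicit.
Unset Printing Implicit Defensive.

Import Order.TTheory GRing.Theory Num.Theory.

Local Open Scope classical_set_scope.
Local Open Scope ring_scope.

(* A walk from x to y is given, as in path.v, by its vertices after x; its
   length is the size of that sequence. *)
Definition has_walk (V : Type) (e : rel V) (x y : V) (k : nat) : Prop :=
  exists p : seq V, [/\ path e x p, last x p = y & size p = k].

Record connected_graph (V : Type) := ConnectedGraph {
  adj :> rel V;
  adj_sym : symmetric adj;
  adj_irr : irreflexive adj;
  adj_conn : forall x y : V, exists k : nat, has_walk adj x y k }.

Lemma has_walkb_ex (V : Type) (G : connected_graph V) (x y : V) :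
  exists k : nat, `[< has_walk G x y k >].
Proof. by have [k Hk] := adj_conn G x y; exists k; apply/asboolP. Qed.

Definition gdist (V : Type) (G : connected_graph V) (x y : V) : nat :=
  ex_minn (has_walkb_ex G x y).

(* The sums below are finitely supported sums (fsbigop.v) over all vertices. *)
Definition F01 (R : realType) (V : choiceType) : set (V -> R) :=
  [set f | [/\ finite_set [set x | f x != 0],
               \sum_(x \in [set: V]) f x = 0
             & \sum_(x \in [set: V]) f x ^+ 2 = 1]].

Definition dist_form (R : realType) (V : choiceType) (G : connected_graph V)
    (f : V -> R) : R :=
  \sum_(x \in [set: V]) \sum_(y \in [set: V]) (gdist G x y)%:R * f x * f y.

(* Extended-real valued: the supremum may be +oo for an infinite graph. *)
Definition QEC (R : realType) (V : choiceType) (G : connected_graph V) : \bar R :=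
  ereal_sup [set (dist_form G f)%:E | f in @F01 R V].

Definition dist_mx (R : realType) (V : finType) (G : connected_graph V) :
    'M[R]_#|V| :=
  \matrix_(i, j) (gdist G (enum_val i) (enum_val j))%:R.

(* There is at most one such s, and there is one when A is symmetric. *)
Definition spectrum (R : realType) (m : nat) (A : 'M[R]_m) : seq R :=
  xget [::] [set s : seq R | sorted >=%R s /\
                             char_poly A = \prod_(a <- s) ('X - a%:P)].

(* Eigenvalues are numbered from 1, sequences from 0. *)
Definition dist_eigenvalue (R : realType) (V : finType) (G : connected_graph V)
    (k : nat) : R :=
  nth 0 (spectrum (dist_mx R G)) k.-1.

(* The vertex numbered i + 1 in {1, ..., n} is i : 'I_n. *)
Definition path_adj (n : nat) (i j : 'I_n) : bool :=
  (i.+1 == j :> nat) || (j.+1 == i :> nat).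

Lemma path_adj_sym (n : nat) : symmetric (@path_adj n).
Proof. by move=> i j; rewrite /path_adj orbC. Qed.

Lemma path_adj_irr (n : nat) : irreflexive (@path_adj n).
Proof. by move=> i; rewrite /path_adj orbb gtn_eqF. Qed.

Lemma path_adj_conn (n : nat) (x y : 'I_n) :
  exists k : nat, has_walk (@path_adj n) x y k.
Proof.
suff /connectP[p xp yl] : connect (@path_adj n) x y by exists (size p), p.
have Hup (k : nat) (i j : 'I_n) : (i + k = j)%N -> connect (@path_adj n) i j.
  elim: k i => [|k IH] i.
    by rewrite addn0 => /val_inj ->; apply: connect0.
  move=> ij; have Hi : (i.+1 < n)%N.
    by apply: leq_ltn_trans (ltn_ord j); rewrite -ij -addSnnS leq_addr.
  apply: (@connect_trans _ _ (Ordinal Hi)).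
    by apply: connect1; rewrite /path_adj /= eqxx.
  by apply: IH; rewrite /= addSnnS.
have [le_xy|/ltnW le_yx] := leqP x y.
  by apply: (Hup (y - x)%N); rewrite subnKC.
rewrite (sym_connect_sym (@path_adj_sym n)).
by apply: (Hup (x - y)%N); rewrite subnKC.
Qed.

Definition path_graph (n : nat) : connected_graph 'I_n :=
  ConnectedGraph (@path_adj_sym n) (@path_adj_irr n) (@path_adj_conn n).

(* Main.v *)
(* Write a function f of sum 0 on the path as f k = F (k + 1) - F k with
   F 0 = F n = 0.  Summation by parts turns the distance form of f into
   -2 sum F^2, so the constant is -2 divided by the largest eigenvalue
   2 (1 + cos (pi / n)) of the Dirichlet Laplacian F |-> sum (F (k + 1) - F k)^2,
   whose eigenvector is E k = (-1)^k sin (k pi / n).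
   The second eigenvalue of a symmetric matrix is at most the maximum of its
   form on a hyperplane, and equality gives an eigenvector in the hyperplane.
   The only candidate is the difference of E; it is antisymmetric under
   reversal of the path exactly when n is even.  The distance matrix sends it
   to QEC times itself plus a constant vector, which vanishes in exactly that
   case.  The trace 0 excludes that this negative eigenvalue is the first. *)
Require Import Defs.
From HB Require Import structures.
From mathcomp Require Import all_boot all_order all_algebra.
From mathcomp Require Import all_fingroup.
From mathcomp Require Import all_classical all_reals all_analysis.
From mathcomp Require Import complex ring lra zify.

Import Order.TTheory GRing.Theory Num.Theory.
Local Open Scope ring_scope.

(** * Real symmetric matrices and their sorted spectrum *)

Lemma symmetric_diagonalizable (R : rcfType) (m : nat) (A : 'M[R]_m) :
  A^T = A ->
  exists2 P : 'M[R]_m, P \in unitmx &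
    exists d : 'rV[R]_m, P *m A = diag_mx d *m P.
Proof.
move=> Asym.
pose toC := real_complex R.
pose AC := map_mx toC A.
have real_toC p q (M : 'M[R]_(p, q)) : map_mx toC M \is a mxOver Num.real.
  by apply/mxOverP => i j; rewrite mxE; apply/complex_realP; exists (M i j).
have lift_real p q (M : 'M[R[i]%C]_(p, q)) : M \is a mxOver Num.real ->
    exists M', M = map_mx toC M'.
  move=> /mxOverP Mreal; exists (map_mx (@complex.Re R) M).
  by apply/matrixP => i j; rewrite !mxE [RHS]RRe_real.
have AChs : AC \is hermsymmx.
  apply: realsym_hermsym; last exact: real_toC.
  by apply/is_hermitianmxP; rewrite map_mx_id// expr0 scale1r map_trmx Asym.
have /orthomx_spectralP := hermitian_normalmx AChs.
have dreal := hermitian_spectral_diag_real AChs.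
have [d dE] := lift_real _ _ _ dreal; rewrite dE => ACE.
have sim : similar_in unitmx AC (diag_mx (map_mx toC d)).
  exists (spectralmx AC); first exact: spectral_unit.
  apply/similarP; first exact: spectral_unit.
  by rewrite {2}ACE !mulmxA mulmxV ?spectral_unit// mul1mx.
(* The spectral theorem gives a similarity over the complex numbers. As [AC] and the diagonal matrix
   are both real, they are also similar through a real matrix, which descends to [R]. *)
have [||P /andP[Preal Punit] /(similarP Punit) PA] := real_similar sim.
- exact: real_toC.
- by rewrite -map_diag_mx; exact: real_toC.
have [P' PE] := lift_real _ _ _ Preal.
exists P'; first by move: Punit; rewrite PE map_unitmx.
exists d; apply/(map_mx_inj (f := toC)).
by rewrite !map_mxM map_diag_mx -PE.
Qed.

Lemma spectrum_diag (R : realType) (m : nat) (A : 'M[R]_m) : A^T = A ->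
  [/\ sorted >=%R (spectrum A), size (spectrum A) = m &
    exists2 P : 'M[R]_m, P \in unitmx &
      P *m A = diag_mx (\row_i (spectrum A)`_i) *m P].
Proof.
move=> /symmetric_diagonalizable[P Punit [d PA]].
have charE : char_poly A = \prod_(a <- [tuple d 0 i | i < m]) ('X - a%:P).
  have -> : A = invmx P *m diag_mx d *m P by rewrite -mulmxA -PA mulKmx.
  rewrite big_image /=.
  have -> : char_poly (invmx P *m diag_mx d *m P) = char_poly (diag_mx d).
    rewrite /char_poly /char_poly_mx !map_mxM /=.
    have PP : map_mx polyC (invmx P) *m map_mx polyC P = 1%:M.
      by rewrite -map_mxM mulVmx// map_mx1.
    have XE : 'X%:M = map_mx polyC (invmx P) *m 'X%:M *m map_mx polyC P.
      by rewrite scalar_mxC -mulmxA PP mulmx1.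
    by rewrite {1}XE -mulmxBl -mulmxBr !det_mulmx mulrAC -det_mulmx PP det1 mul1r.
  rewrite char_poly_trig ?diag_mx_is_trig//.
  by apply: eq_bigr => i _; rewrite mxE eqxx.
have [srt char] : [set s : seq R | sorted >=%R s /\
    char_poly A = \prod_(a <- s) ('X - a%:P)]%classic (spectrum A).
  (* The sorted diagonal is a witness, so [xget] does not fall back on its default. *)
  apply: xgetPex; exists (sort >=%R [tuple d 0 i | i < m]); split.
    by apply: sort_sorted => x y; rewrite orbC; exact: le_total.
  by rewrite charE; apply: perm_big; rewrite perm_sym perm_sort.
have perm_d : perm_eq (spectrum A) [tuple d 0 i | i < m].
  by apply: prod_XsubC_eq; rewrite -char charE.
split=> //; first by rewrite (perm_size perm_d) size_tuple.
(* Permuting the rows of the eigenbasis like the eigenvalues lists the latter in the order of the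
   spectrum. *)
have /tuple_permP[p pE] := perm_d.
exists (row_perm p P); first by rewrite row_permE unitmx_mul unitmx_perm.
rewrite [X in X *m A]row_permE -mulmxA PA -row_permE !mul_diag_mx.
apply/matrixP => i j; rewrite !mxE pE.
by rewrite (nth_map i) ?size_enum_ord// nth_ord_enum tnth_mktuple.
Qed.

(* The span of the first two rows of an eigenbasis meets the hyperplane
   h *m w = 0; the form is at least the second eigenvalue on that span. *)
Lemma second_eigenvalue_le (R : realType) (m : nat) (A : 'M[R]_m)
    (w : 'cV[R]_m) (mu : R) : (2 <= m)%N -> A^T = A ->
  (forall h : 'rV[R]_m, (h *m w) 0 0 = 0 ->
     (h *m A *m h^T) 0 0 <= mu * (h *m h^T) 0 0) ->
  (spectrum A)`_1 <= mu /\
  ((spectrum A)`_1 = mu -> exists h : 'rV[R]_m,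
    [/\ h != 0, (h *m w) 0 0 = 0 & h *m A = mu *: h]).
Proof.
move=> m_ge2 Asym Amu.
have [srt sz [P Punit PA]] := spectrum_diag _ _ _ Asym.
set s := spectrum A in srt sz PA *.
pose i0 : 'I_m := Ordinal (ltnW m_ge2); pose i1 : 'I_m := Ordinal m_ge2.
pose p := row i0 P; pose q := row i1 P.
have pA : p *m A = s`_0 *: p.
  by rewrite -row_mul PA mul_diag_mx; apply/rowP => j; rewrite !mxE.
have qA : q *m A = s`_1 *: q.
  by rewrite -row_mul PA mul_diag_mx; apply/rowP => j; rewrite !mxE.
have s10 : s`_1 <= s`_0.
  have: (1 < size s)%N by rewrite sz.
  by case: (s) srt => [|a [|b t]]//= /andP[].
have pq_free a b : a *: p + b *: q = 0 -> a = 0 /\ b = 0.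
  move=> /(congr1 (mulmx^~ (invmx P))); rewrite mul0mx mulmxDl -!scalemxAl.
  rewrite -!row_mul mulmxV// => /rowP E.
  by have := E i0; have := E i1; rewrite !mxE /= !mulr0 !mulr1 add0r addr0.
have sq_ge0 (v : 'rV[R]_m) : 0 <= (v *m v^T) 0 0.
  by rewrite mxE sumr_ge0// => j _; rewrite mxE -expr2 sqr_ge0.
have sq_eq0 (v : 'rV[R]_m) : (v *m v^T) 0 0 = 0 -> v = 0.
  rewrite mxE => /eqP; rewrite psumr_eq0 => [/allP v0|j _]; last first.
    by rewrite mxE -expr2 sqr_ge0.
  apply/rowP => j; rewrite !mxE; apply/eqP; have := v0 j (mem_index_enum j).
  by rewrite mxE -expr2 sqrf_eq0.
have [a [b [ab0 hw]]] : exists a b, (a != 0) || (b != 0) /\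
    ((a *: p + b *: q) *m w) 0 0 = 0.
  have [pw|pw] := eqVneq ((p *m w) 0 0) 0.
    by exists 1, 0; rewrite oner_eq0 scale1r scale0r addr0.
  exists (- (q *m w) 0 0), ((p *m w) 0 0); rewrite pw orbT; split=> //.
  by rewrite mulmxDl -!scalemxAl !mxE; ring.
set h := a *: p + b *: q in hw.
have h0 : h != 0.
  by apply: contraTneq ab0 => /pq_free[-> ->]; rewrite eqxx.
have hA : h *m A = s`_1 *: h + (a * (s`_0 - s`_1)) *: p.
  rewrite mulmxDl -!scalemxAl pA qA.
  by apply/rowP => j; rewrite !mxE; ring.
have ZE c (M : 'M[R]_1) : (c *: M) 0 0 = c * M 0 0 by rewrite mxE.
have DE (M N : 'M[R]_1) : (M + N) 0 0 = M 0 0 + N 0 0 by rewrite mxE.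
(* [P] is only known to be invertible. Symmetry of [A] makes [p] and [q] orthogonal when their
   eigenvalues differ; keeping the factor covers the equal case too. *)
have pq_orth : (s`_0 - s`_1) * (p *m q^T) 0 0 = 0.
  have : (p *m A *m q^T) 0 0 = (q *m A *m p^T) 0 0.
    by rewrite -[in RHS](trmxK (q *m A *m p^T)) [RHS]mxE !trmx_mul trmxK Asym mulmxA.
  have qp : (q *m p^T) 0 0 = (p *m q^T) 0 0.
    by rewrite !mxE; apply: eq_bigr => j _; rewrite !mxE mulrC.
  by rewrite pA qA -!scalemxAl !ZE qp mulrBl => ->; rewrite subrr.
have hAh : (h *m A *m h^T) 0 0 =
    s`_1 * (h *m h^T) 0 0 + (s`_0 - s`_1) * (a ^+ 2 * (p *m p^T) 0 0).
  have ph : (p *m h^T) 0 0 = a * (p *m p^T) 0 0 + b * (p *m q^T) 0 0.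
    by rewrite /h linearD !linearZ mulmxDr -!scalemxAr DE !ZE.
  rewrite hA mulmxDl -!scalemxAl DE !ZE ph; congr (_ + _).
  rewrite (_ : _ * (_ + _) = (s`_0 - s`_1) * (a ^+ 2 * (p *m p^T) 0 0) +
    a * b * ((s`_0 - s`_1) * (p *m q^T) 0 0)); last by ring.
  by rewrite pq_orth mulr0 addr0.
have hh : 0 < (h *m h^T) 0 0.
  by rewrite lt_neqAle sq_ge0 andbT eq_sym; apply: contra h0 => /eqP/sq_eq0/eqP.
have ext_ge0 : 0 <= (s`_0 - s`_1) * (a ^+ 2 * (p *m p^T) 0 0).
  by apply: mulr_ge0; [rewrite subr_ge0|apply: mulr_ge0; [exact: sqr_ge0|exact: sq_ge0]].
have := Amu h hw; rewrite hAh => hmu; split.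
  by rewrite -(ler_pM2r hh); apply: le_trans hmu; rewrite lerDl.
move=> s1mu; exists h; split=> //; rewrite hA s1mu.
(* Equality forces the nonnegative term of [ext_ge0] to vanish. One of its factors is then 0, and
   each of them kills the part of [h *m A] that is not a multiple of [h]. *)
suff -> : a * (s`_0 - mu) *: p = 0 by rewrite addr0.
have : (s`_0 - s`_1) * (a ^+ 2 * (p *m p^T) 0 0) == 0.
  by rewrite eq_le ext_ge0 andbT -(lerD2l (s`_1 * (h *m h^T) 0 0)) addr0 {3}s1mu.
rewrite s1mu !mulf_eq0 orbb => /or3P[/eqP->|/eqP->|/eqP/sq_eq0->].
- by rewrite mulr0 scale0r.
- by rewrite mul0r scale0r.
- by rewrite scaler0.
Qed.

(** The value [mu] sits somewhere in the spectrum. In first place it would make all eigenvalues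
    negative, against trace 0; in any later place it is at most the second eigenvalue. *)
Lemma second_eigenvalue_eq (R : realType) (m : nat) (A : 'M[R]_m)
    (mu : R) (h : 'rV[R]_m) : (2 <= m)%N -> A^T = A -> \tr A = 0 -> mu < 0 ->
  (spectrum A)`_1 <= mu -> h != 0 -> h *m A = mu *: h -> (spectrum A)`_1 = mu.
Proof.
move=> m_ge2 Asym trA mu0 s1mu h0 hA.
have [srt sz [P Punit PA]] := spectrum_diag _ _ _ Asym.
set s := spectrum A in srt sz PA s1mu *.
have trs : \sum_(i < m) s`_i = 0.
  rewrite -[RHS]trA -[in RHS](mulKmx Punit A) PA mxtrace_mulC -mulmxA mulmxV// mulmx1.
  by rewrite mxtrace_diag; apply: eq_bigr => i _; rewrite mxE.
have s_le i j : (i <= j < m)%N -> s`_j <= s`_i.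
  move=> /andP[ij jm].
  have ge_trans : transitive (>=%R : rel R) by move=> x y z /[swap]; exact: le_trans.
  by apply: (sorted_leq_nth ge_trans (@lexx _ _) 0 srt) => //;
    rewrite inE sz// (leq_ltn_trans ij).
have [i si] : exists i : 'I_m, s`_i = mu.
  (* The coordinates of [h] in the eigenbasis; a nonzero one marks an index with eigenvalue [mu]. *)
  pose g := h *m invmx P.
  have g0 : g != 0.
    by apply: contra h0 => /eqP g0; rewrite -(mulmxKV Punit h) -/g g0 mul0mx.
  have gE : g *m diag_mx (\row_i s`_i) = mu *: g.
    rewrite /g scalemxAl -hA -[in RHS](mulKmx Punit A) PA !mulmxA.
    by rewrite mulmxK.
  move: g g0 gE => g /rV0Pn[i gi] gE.
  exists i; apply: (mulIf gi).
  by move/rowP: gE => /(_ i); rewrite mul_mx_diag !mxE mulrC.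
apply/eqP; rewrite eq_le s1mu /=.
have [i0|i_gt0] := posnP i; last by rewrite -si s_le// i_gt0 /=.
suff : \sum_(i < m) s`_i < 0 by rewrite trs ltxx.
have sle (j : 'I_m) : s`_j <= mu by rewrite -si i0 s_le/=.
apply: (@le_lt_trans _ _ (\sum_(j < m) mu)); first exact: ler_sum.
by rewrite sumr_const card_ord pmulrn_llt0// ltnW.
Qed.

(** * Summation by parts against the distance on a line *)

Lemma signed_telescope (R : comRingType) (u : nat -> R) (n x : nat) :
  \sum_(y < n) (-1) ^+ (x <= y)%N * (u y.+1 - u y) =
  2 * u (minn x n) - u n - u 0%N.
Proof.
elim: n => [|n IHn]; first by rewrite big_ord0 minn0; ring.
rewrite big_ord_recr /= IHn; case: (leqP x n) => xn.
  by rewrite (minn_idPl (leq_trans xn (leqnSn n))); ring.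
by rewrite (minn_idPr xn) /=; ring.
Qed.

(** With truncated subtraction the kernel is the absolute difference of [x] and [y]. Its increment
    in [y] is -1 before [x] and +1 from [x] on, the negative of the sign on the right. *)
Lemma dist_by_parts (R : comRingType) (F : nat -> R) (n x : nat) :
  F 0%N = 0 -> F n = 0 ->
  \sum_(y < n) ((x - y) + (y - x))%:R * (F y.+1 - F y) =
  \sum_(y < n) (-1) ^+ (x <= y)%N * F y.+1.
Proof.
move=> F0 Fn; pose d y : R := ((x - y) + (y - x))%:R.
suff H m : \sum_(y < m) d y * (F y.+1 - F y) =
    d m * F m + \sum_(y < m) (-1) ^+ (x <= y)%N * F y.+1.
  by rewrite H Fn mulr0 add0r.
elim: m => [|m IHm]; first by rewrite !big_ord0 F0 mulr0 addr0.
rewrite !big_ord_recr /= IHm.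
have -> : d m.+1 = d m - (-1) ^+ (x <= m)%N.
  rewrite /d; case: leqP => xm /=.
    by rewrite (_ : x - m.+1 + _ = (x - m + (m - x)).+1)%N; [rewrite -natr1; ring|lia].
  by rewrite (_ : x - m + _ = (x - m.+1 + (m.+1 - x)).+1)%N; [rewrite -natr1; ring|lia].
by ring.
Qed.

(** Summation by parts in both variables diagonalizes the form: the mixed difference of the distance
    is -2 times the unit mass on the diagonal. *)
Lemma dist_form_by_parts (R : comRingType) (F : nat -> R) (n : nat) :
  F 0%N = 0 -> F n = 0 ->
  \sum_(x < n) \sum_(y < n) ((x - y) + (y - x))%:R *
     (F x.+1 - F x) * (F y.+1 - F y) =
  - 2 * \sum_(y < n) F y.+1 ^+ 2.
Proof.
move=> F0 Fn.
under eq_bigr => x _.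
  under eq_bigr => y _ do rewrite mulrAC mulrC.
  rewrite -mulr_sumr dist_by_parts// mulr_sumr; over.
rewrite exchange_big mulr_sumr; apply: eq_bigr => y _ /=.
(* Seen as a function of [x], the sign jumps at [y.+1] in the opposite direction. *)
transitivity (\sum_(x < n) - F y.+1 * ((-1) ^+ (y.+1 <= x)%N * (F x.+1 - F x))).
  by apply: eq_bigr => x _; rewrite ltnNge; case: (x <= y)%N => /=; ring.
rewrite -mulr_sumr signed_telescope (minn_idPl (ltn_ord y)) F0 Fn; ring.
Qed.

(** Green's identity for an eigenfunction of the discrete Laplacian. The boundary term
    [F m * (F m.+1 - F m)] vanishes at both ends. *)
Lemma sum_sq_by_parts (R : comRingType) (F : nat -> R) (n : nat) (c : R) :
  F 0%N = 0 -> F n = 0 ->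
  (forall k, F k.+2 - 2 * F k.+1 + F k = - c * F k.+1) ->
  \sum_(x < n) (F x.+1 - F x) ^+ 2 = c * \sum_(y < n) F y.+1 ^+ 2.
Proof.
move=> F0 Fn rec.
suff H m : \sum_(x < m) (F x.+1 - F x) ^+ 2 =
    F m * (F m.+1 - F m) + c * \sum_(y < m) F y.+1 ^+ 2.
  by rewrite H Fn mul0r add0r.
elim: m => [|m IHm]; first by rewrite !big_ord0 F0; ring.
rewrite !big_ord_recr /= IHm.
have -> : F m.+2 = - c * F m.+1 + 2 * F m.+1 - F m by rewrite -rec; ring.
by ring.
Qed.

(** * The sharp Dirichlet inequality on the path and its extremal function *)

Section Path.
Variables (R : realType) (n : nat).
Hypothesis n_ge2 : (2 <= n)%N.

Let t : R := pi / n%:R.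
Let c : R := cos t.
Let mu : R := - 1 / (1 + c).
Let s (k : nat) : R := sin (k%:R * t).

Let n_gt0 : 0 < n%:R :> R. Proof. by rewrite ltr0n ltnW. Qed.

Let s_gt0 k : (0 < k < n)%N -> 0 < s k.
Proof.
move=> /andP[k0 kn]; apply: sin_gt0_pi; apply/andP; split.
  by rewrite mulr_gt0 ?divr_gt0 ?pi_gt0 ?n_gt0 ?ltr0n.
by rewrite /t mulrCA gtr_pMr ?pi_gt0// ltr_pdivrMr// mul1r ltr_nat.
Qed.

Let s0 : s 0%N = 0. Proof. by rewrite /s mul0r sin0. Qed.
Let sn : s n = 0.
Proof. by rewrite /s /t mulrC divfK ?gt_eqF// sinpi. Qed.

Let s_rec k : s k.+2 + s k = 2 * c * s k.+1.
Proof.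
rewrite /s -[k.+2]addn1 -[in k%:R](addKn 1 k) add1n natrB// natrD mulrDl mulrBl.
by rewrite mul1r sinD sinB /c; ring.
Qed.

Let s_last : s n.-1 = s 1%N.
Proof.
rewrite /s -subn1 natrB ?(ltnW n_ge2)// mulrBl mul1r [n%:R * t]mulrC /t.
by rewrite divfK ?gt_eqF// sinB sinpi cospi; ring.
Qed.

Let c1_gt0 : 0 < 1 + c.
Proof.
rewrite ltr_pwDl// /c cos_ge0_pihalf// /t.
have t0 : 0 <= pi / n%:R :> R by rewrite divr_ge0 ?pi_ge0.
rewrite (le_trans _ t0) ?oppr_le0 ?divr_ge0 ?pi_ge0//=.
by rewrite ler_pM2l ?pi_gt0// lef_pV2 ?posrE ?n_gt0// (ler_nat R 2 n).
Qed.

Lemma path_mu_lt0 : mu < 0.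
Proof. by rewrite /mu mulN1r oppr_lt0 invr_gt0. Qed.

(* AM-GM: - 2 F_k F_(k+1) <= s_(k+1) / s_k F_k^2 + s_k / s_(k+1) F_(k+1)^2,
   where the two coefficients of each F_k^2 add up to 2 c. *)
Let amgm (F : nat -> R) m : F 0%N = 0 -> (0 < m < n)%N ->
  \sum_(k < m) - 2 * F k * F k.+1 <=
  2 * c * (\sum_(k < m) F k.+1 ^+ 2) - s m.+1 / s m * F m ^+ 2.
Proof.
move=> F0; elim: m => // -[_ _|m IHm /= mn].
  rewrite !big_ord1 F0 mulr0 mul0r.
  have := s_rec 0; rewrite s0 addr0 => ->.
  by rewrite mulfK ?subrr// gt_eqF// s_gt0.
have s1 : 0 < s m.+1 by rewrite s_gt0//= ltnW.
have s2 : 0 < s m.+2 by rewrite s_gt0.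
rewrite big_ord_recr [in leRHS]big_ord_recr /=.
have := IHm (ltnW mn); set S := \sum_(k < _) _; set T := \sum_(k < _) _ => ST.
have -> : s m.+3 = 2 * c * s m.+2 - s m.+1 by rewrite -s_rec addrK.
set x := F m.+1 in ST *; set y := F m.+2.
(* This square is the AM-GM step for the product [x * y]. The term subtracted in the induction
   hypothesis is the share of [2 * c * x ^+ 2] reserved for it. *)
have : 0 <= (s m.+2 * x + s m.+1 * y) ^+ 2 / (s m.+1 * s m.+2).
  by rewrite divr_ge0 ?sqr_ge0// ltW// mulr_gt0.
have -> : (s m.+2 * x + s m.+1 * y) ^+ 2 / (s m.+1 * s m.+2) =
    s m.+2 / s m.+1 * x ^+ 2 + 2 * x * y + s m.+1 / s m.+2 * y ^+ 2.
  by field; rewrite !gt_eqF.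
have -> : (2 * c * s m.+2 - s m.+1) / s m.+2 = 2 * c - s m.+1 / s m.+2.
  by field; rewrite gt_eqF.
by move: ST; rewrite mulrDr; nra.
Qed.

Lemma path_poincare (F : nat -> R) : F 0%N = 0 -> F n = 0 ->
  \sum_(k < n) (F k.+1 - F k) ^+ 2 <=
  2 * (1 + c) * \sum_(k < n) F k.+1 ^+ 2.
Proof.
move=> F0 Fn.
have Hn : n = n.-1.+1 by rewrite prednK// ltnW.
(* At [n.-1] the reserved term has the factor [s n = 0], and the remaining product of neighbours
   contains [F n = 0]. *)
have := amgm F n.-1 F0; rewrite -Hn sn mul0r mul0r subr0 => /(_ ltac:(lia)).
have sqE m : \sum_(k < m) (F k.+1 - F k) ^+ 2 =
    2 * (\sum_(k < m) F k.+1 ^+ 2) - F m ^+ 2 + \sum_(k < m) - 2 * F k * F k.+1.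
  elim: m => [|m IHm]; first by rewrite !big_ord0 F0; ring.
  by rewrite !big_ord_recr /= IHm; ring.
move=> H; rewrite sqE Fn Hn !big_ord_recr /= -Hn Fn; move: H.
by set S := \sum_(k < _) _; set T := \sum_(k < _) _; lra.
Qed.

Let mu_c : mu * (2 * (1 + c)) = - 2.
Proof. by rewrite /mu; field; rewrite gt_eqF. Qed.

Lemma path_form_le (F : nat -> R) : F 0%N = 0 -> F n = 0 ->
  \sum_(x < n) \sum_(y < n) ((x - y) + (y - x))%:R *
     (F x.+1 - F x) * (F y.+1 - F y) <=
  mu * \sum_(x < n) (F x.+1 - F x) ^+ 2.
Proof.
move=> F0 Fn; rewrite dist_form_by_parts// -mu_c -mulrA ler_nM2l ?path_mu_lt0//.
exact: path_poincare.
Qed.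

(** The alternating sign turns the lowest Dirichlet mode, with eigenvalue [2 * (1 - c)], into the
    highest one, with eigenvalue [2 * (1 + c)]. *)
Definition path_ext (k : nat) : R := (-1) ^+ k * sin (k%:R * (pi / n%:R)).
Let E := path_ext.

Let ES k : E k = (-1) ^+ k * s k. Proof. by []. Qed.

Let E_rec k : E k.+2 - 2 * E k.+1 + E k = - (2 * (1 + c)) * E k.+1.
Proof.
have -> : E k.+2 = (-1) ^+ k * (2 * c * s k.+1 - s k).
  by rewrite -s_rec addrK ES !exprS; ring.
by rewrite !ES exprS; ring.
Qed.

Lemma path_ext0 : path_ext 0 = 0. Proof. by rewrite [LHS]ES s0 mulr0. Qed.
Lemma path_extn : path_ext n = 0. Proof. by rewrite [LHS]ES sn mulr0. Qed.

Lemma path_ext1_lt0 : path_ext 1 < 0.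
Proof. by rewrite [ltLHS]ES expr1 mulN1r oppr_lt0 s_gt0. Qed.

Let E0 : E 0%N = 0 := path_ext0.
Let En : E n = 0 := path_extn.
Let E1_lt0 : E 1%N < 0 := path_ext1_lt0.

Lemma path_form_ext :
  \sum_(x < n) \sum_(y < n) ((x - y) + (y - x))%:R *
     (E x.+1 - E x) * (E y.+1 - E y) =
  mu * \sum_(x < n) (E x.+1 - E x) ^+ 2.
Proof.
rewrite dist_form_by_parts ?E0 ?En//.
rewrite (@sum_sq_by_parts _ E n (2 * (1 + c))) ?E0 ?En//.
by rewrite mulrA mu_c.
Qed.

(** By [E_rec] each [E y.+1] is a multiple of a difference of [f], so the signed sum telescopes to
    [mu * f x] minus a multiple of [f n + f 0]. Since [s n.+1 = - s 1], this constant is 0 for even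
    [n]. *)
Lemma path_ext_eigen (x : nat) : ~~ odd n -> (x < n)%N ->
  \sum_(y < n) ((x - y) + (y - x))%:R * (E y.+1 - E y) = mu * (E x.+1 - E x).
Proof.
move=> n_even xn; rewrite dist_by_parts ?E0 ?En//.
pose f k := E k.+1 - E k.
transitivity (mu / 2 * \sum_(y < n) (-1) ^+ (x <= y)%N * (f y.+1 - f y)).
  rewrite mulr_sumr; apply: eq_bigr => y _.
  have -> : f y.+1 - f y = - (2 * (1 + c)) * E y.+1 by rewrite -E_rec /f; ring.
  have mu_c' : mu / 2 * - (2 * (1 + c)) = 1.
    by rewrite mulrAC mulrN mu_c opprK divff.
  by rewrite [RHS]mulrCA [_ / 2 * _]mulrA mu_c' mul1r.
have fn0 : f n + f 0%N = 0.
  have Hn : n = n.-1.+1 by rewrite prednK// ltnW.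
  have : s n.+1 = - s 1%N.
    have := s_rec n.-1; rewrite -Hn sn mulr0 s_last => /eqP.
    by rewrite addr_eq0 => /eqP.
  rewrite /f E0 En !ES exprS expr1 -signr_odd (negbTE n_even) => ->.
  by rewrite expr0; ring.
rewrite signed_telescope (minn_idPl (ltnW xn)) -addrA -opprD fn0 subr0 /f.
by field.
Qed.

(** Differencing the eigenvalue equation gives the recurrence of [E], so [F] is a multiple of [E].
    The equation at the two ends makes [F] agree at [1] and [n.-1], where [E] has opposite nonzero
    values for odd [n]. *)
Lemma path_eigen_odd (F : nat -> R) : odd n -> F 0%N = 0 -> F n = 0 ->
  (forall x : 'I_n, \sum_(y < n) ((x - y) + (y - x))%:R * (F y.+1 - F y) =
     mu * (F x.+1 - F x)) ->
  forall k, (k <= n)%N -> F k = 0.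
Proof.
move=> n_odd F0 Fn eigen.
have Hn : n = n.-1.+1 by rewrite prednK// ltnW.
(* Partial sums of [F] make the signed sum telescope; the constant [U n] disappears on
   differencing. *)
pose U k := \sum_(i < k.+1) F i.
have US k : U k.+1 = U k + F k.+1 by rewrite /U big_ord_recr.
have U0 : U 0%N = 0 by rewrite /U big_ord1.
have eigenU x : (x < n)%N -> 2 * U x - U n = mu * (F x.+1 - F x).
  move=> xn; rewrite -(eigen (Ordinal xn)) dist_by_parts//.
  rewrite -[LHS]subr0 -[in LHS]U0 -[in U x](minn_idPl (ltnW xn)) -signed_telescope.
  by apply: eq_bigr => y _; rewrite US addrAC subrr add0r.
have rec k : (k.+1 < n)%N -> F k.+2 - 2 * F k.+1 + F k = - (2 * (1 + c)) * F k.+1.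
  move=> kn; apply: (mulfI (ltr0_neq0 path_mu_lt0)).
  rewrite mulrA mulrN mu_c opprK.
  have := eigenU _ kn; have := eigenU _ (ltnW kn); rewrite US => H1 H2.
  rewrite (_ : mu * _ = mu * (F k.+2 - F k.+1) - mu * (F k.+1 - F k)); last by ring.
  by rewrite -H1 -H2; ring.
pose a := F 1%N / E 1%N.
have FE k : (k < n)%N -> F k = a * E k /\ F k.+1 = a * E k.+1.
  elim: k => [_|k IHk kn].
    by rewrite F0 E0 mulr0 /a divfK// lt_eqF// E1_lt0.
  have [Fk Fk1] := IHk (ltnW kn); split=> //.
  have := rec k kn; have := E_rec k; rewrite Fk Fk1 => HE HF.
  have -> : F k.+2 = - (2 * (1 + c)) * (a * E k.+1) + 2 * (a * E k.+1) - a * E k.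
    by rewrite -HF; ring.
  have -> : E k.+2 = - (2 * (1 + c)) * E k.+1 + 2 * E k.+1 - E k.
    by rewrite -HE; ring.
  by ring.
have ends : F n.-1 = F 1%N.
  have := eigenU 0 (ltnW n_ge2); have := eigenU n.-1 ltac:(lia).
  rewrite -Hn Fn F0 U0 [in U n]Hn US -Hn Fn => H1 H2.
  apply: (mulfI (ltr0_neq0 path_mu_lt0)).
  by move: H1 H2; rewrite !sub0r !subr0 !mulrN; lra.
have a0 : a = 0.
  have [+ _] := FE n.-1 ltac:(lia); have [_ F1] := FE 0%N (ltnW n_ge2).
  rewrite ends F1 !ES s_last -(signr_odd _ n.-1).
  rewrite (_ : odd n.-1 = false); last by move: n_odd; rewrite {1}Hn /=; case: odd.
  rewrite expr0 expr1 mul1r mulN1r mulrN => /eqP.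
  have := s_gt0 1 n_ge2; set b := s 1 => b0.
  rewrite -subr_eq0 -opprD oppr_eq0 -mulr2n mulrn_eq0 /= mulf_eq0 (gt_eqF b0) orbF.
  by move/eqP.
case=> [//|k kn]; have [_ ->] := FE k kn.
by rewrite a0 mul0r.
Qed.

End Path.

(** * Path distances, and the constant and distance matrix of a finite graph *)

Lemma gdist_path (n : nat) (x y : 'I_n) :
  gdist (path_graph n) x y = ((x - y) + (y - x))%N.
Proof.
rewrite /gdist; case: ex_minnP => k /asboolP[p [xp yl <-]] kmin.
apply/eqP; rewrite eqn_leq; apply/andP; split; last first.
  (* An edge changes the position by one, so no walk is shorter than the difference of positions. *)
  elim: p x xp yl {kmin} => [|z p IHp] x /=; first by move=> _ ->; lia.
  move=> /andP[xz zp] /(IHp _ zp); move: xz; rewrite /path_adj.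
  by move=> /orP[] /eqP; lia.
apply: kmin; apply/asboolP; clear.
have [k kE] : exists k, k = ((x - y) + (y - x))%N by eexists.
rewrite -kE; elim: k x kE => [|k IHk] x kE.
  exists [::]; split=> //=; apply: ord_inj; lia.
(* The neighbour of [x] one step closer to [y]. *)
have [z xz zE] : exists2 z : 'I_n, path_adj x z & k = ((z - y) + (y - z))%N.
  have [xy|yx] := ltnP x y.
    have zn : (x.+1 < n)%N by apply: leq_ltn_trans (ltn_ord y).
    by exists (Ordinal zn); rewrite /path_adj /= ?eqxx//; lia.
  have zn : (x.-1 < n)%N by apply: leq_ltn_trans (ltn_ord x); lia.
  exists (Ordinal zn); rewrite /path_adj /=; last by lia.
  by apply/orP; right; apply/eqP; lia.
have [p [zp yl sp]] := IHk z zE.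
by exists (z :: p); split=> /=; rewrite ?xz ?sp.
Qed.

Lemma fsbig_finType (R : Type) (idx : R) (op : Monoid.com_law idx)
    (V : finType) (f : V -> R) :
  \big[op/idx]_(x \in [set: V]%classic) f x = \big[op/idx]_x f x.
Proof.
rewrite (_ : [set: V] = [set` enum V])%classic.
  by rewrite -fsbig_seq ?enum_uniq// big_enum.
by apply/seteqP; split=> x //= _; rewrite mem_enum.
Qed.

Lemma sum0_ord_telescope (R : zmodType) (n : nat) (g : 'I_n -> R) :
  \sum_i g i = 0 -> exists F : nat -> R,
    [/\ F 0%N = 0, F n = 0 & forall i : 'I_n, g i = F i.+1 - F i].
Proof.
move=> g0; exists (fun k => \sum_(i < n | (i < k)%N) g i); split.
- by rewrite big_pred0.
- by rewrite -[RHS]g0; apply: eq_bigl => i; rewrite ltn_ord.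
move=> i; rewrite (bigD1 i) /= ?ltnSn//.
rewrite (eq_bigl (fun j : 'I_n => (j < i)%N)) ?addrK// => j.
by rewrite ltnS ltn_neqAle andbC.
Qed.

Lemma dist_formE (R : realType) (V : finType) (G : connected_graph V)
    (f : V -> R) :
  dist_form G f = \sum_x \sum_y (gdist G x y)%:R * f x * f y.
Proof.
rewrite /dist_form fsbig_finType; apply: eq_bigr => x _.
by rewrite fsbig_finType.
Qed.

(** On [F01] the squares sum to 1, so [mu] is an upper bound; [f0] scaled to unit norm attains
    it. *)
Lemma QEC_finE (R : realType) (V : finType) (G : connected_graph V)
    (mu : R) (f0 : V -> R) :
  (forall f : V -> R, \sum_x f x = 0 ->
     dist_form G f <= mu * \sum_x f x ^+ 2) ->
  \sum_x f0 x = 0 -> (exists x, f0 x != 0) ->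
  dist_form G f0 = mu * \sum_x f0 x ^+ 2 ->
  QEC R G = mu%:E.
Proof.
move=> le_mu sum0 [x0 fx0] eq_mu; apply/eqP; rewrite eq_le; apply/andP; split.
  apply: ge_ereal_sup => _ [f [_ + +] <-]; rewrite !fsbig_finType => fsum fsq.
  by rewrite lee_fin; apply: le_trans (le_mu f fsum) _; rewrite fsq mulr1.
apply: ereal_sup_ubound; set S := \sum_x _ in eq_mu.
have S0 : 0 < S.
  rewrite /S (bigD1 x0)//= ltr_pwDl ?exprn_even_gt0//.
  by rewrite sumr_ge0// => x _; exact: sqr_ge0.
pose r := Num.sqrt S; have r2 : r ^+ 2 = S by rewrite sqr_sqrtr// ltW.
exists (fun x => f0 x / r); first split.
- exact: finite_finset.
- by rewrite fsbig_finType -mulr_suml sum0 mul0r.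
- rewrite fsbig_finType; under eq_bigr do rewrite expr_div_n r2.
  by rewrite -mulr_suml divff// gt_eqF.
congr EFin; transitivity (dist_form G f0 / S).
  rewrite !dist_formE mulr_suml; apply: eq_bigr => x _.
  rewrite mulr_suml; apply: eq_bigr => y _.
  by rewrite -r2 expr2 invfM; ring.
by rewrite eq_mu mulfK// gt_eqF.
Qed.

Lemma big_ord_enum_val (R : nmodType) (V : finType) (f : 'I_#|V| -> R) :
  \sum_i f i = \sum_(x : V) f (enum_rank x).
Proof. by apply: reindex; exact: onW_bij (enum_rank_bij V). Qed.

Lemma dist_mxE (R : realType) (V : finType) (G : connected_graph V)
    (h : 'rV[R]_#|V|) (y : V) :
  (h *m dist_mx R G) 0 (enum_rank y) =
  \sum_x h 0 (enum_rank x) * (gdist G x y)%:R.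
Proof.
rewrite mxE big_ord_enum_val; apply: eq_bigr => x _.
by rewrite mxE !enum_rankK.
Qed.

Lemma dist_mx_form (R : realType) (V : finType) (G : connected_graph V)
    (h : 'rV[R]_#|V|) :
  (h *m dist_mx R G *m h^T) 0 0 = dist_form G (fun x => h 0 (enum_rank x)).
Proof.
rewrite dist_formE mxE big_ord_enum_val exchange_big; apply: eq_bigr => y _ /=.
rewrite dist_mxE mxE mulr_suml; apply: eq_bigr => x _; ring.
Qed.

Lemma gdist_sym (V : Type) (G : connected_graph V) (x y : V) :
  gdist G x y = gdist G y x.
Proof.
suff H a b : (gdist G a b <= gdist G b a)%N by apply/eqP; rewrite eqn_leq !H.
rewrite {1}/gdist; case: ex_minnP => k _; apply.
rewrite /gdist; case: ex_minnP => m /asboolP[p [bp pa pm]] _.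
(* The walk traversed backwards: its starting vertex is dropped, hence [belast]. *)
apply/asboolP; exists (rev (belast b p)); split.
- rewrite -pa rev_path; apply: sub_path bp => u v /=.
  by rewrite adj_sym.
- by case: (p) pa => [/= ->|z q _] //=; rewrite rev_cons last_rcons.
- by rewrite size_rev size_belast.
Qed.

Lemma dist_mx_sym (R : realType) (V : finType) (G : connected_graph V) :
  (dist_mx R G)^T = dist_mx R G.
Proof. by apply/matrixP => i j; rewrite !mxE gdist_sym. Qed.

Lemma gdist_refl (V : Type) (G : connected_graph V) (x : V) : gdist G x x = 0%N.
Proof.
rewrite /gdist; case: ex_minnP => k _ /(_ 0%N).
rewrite leqn0 => H; apply/eqP; apply: H; apply/asboolP.
by exists [::].
Qed.

Lemma dist_mx_trace (R : realType) (V : finType) (G : connected_graph V) :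
  \tr (dist_mx R G) = 0.
Proof. by rewrite /mxtrace big1// => i _; rewrite mxE gdist_refl. Qed.

Lemma sum_sqE (R : realType) (V : finType) (h : 'rV[R]_#|V|) :
  (h *m h^T) 0 0 = \sum_x h 0 (enum_rank x) ^+ 2.
Proof. by rewrite mxE big_ord_enum_val; apply: eq_bigr => x _; rewrite mxE expr2. Qed.

Lemma sum_allones (R : realType) (V : finType) (h : 'rV[R]_#|V|) :
  (h *m (const_mx 1 : 'cV_#|V|)) 0 0 = \sum_x h 0 (enum_rank x).
Proof. by rewrite mxE big_ord_enum_val; apply: eq_bigr => x _; rewrite mxE mulr1. Qed.

(** * The constant of the path against its second distance eigenvalue *)

Theorem theorem1p1 (R : realType) (n : nat) (hn : (2 <= n)%N) :
  [/\ QEC R (path_graph n) = (- 1 / (1 + cos (pi / n%:R)))%:E,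
      ~~ odd n ->
        (dist_eigenvalue R (path_graph n) 2)%:E = QEC R (path_graph n)
    & odd n ->
        ((dist_eigenvalue R (path_graph n) 2)%:E < QEC R (path_graph n))%E].
Proof.
set mu := - 1 / (1 + _).
pose E := path_ext R n.
have E0 : E 0%N = 0 := path_ext0 R n.
have En : E n = 0 := path_extn R n hn.
have formE (F : nat -> R) : dist_form (path_graph n) (fun i : 'I_n => F i.+1 - F i) =
    \sum_(x < n) \sum_(y < n) ((x - y) + (y - x))%:R *
      (F x.+1 - F x) * (F y.+1 - F y).
  rewrite dist_formE; apply: eq_bigr => x _; apply: eq_bigr => y _.
  by rewrite gdist_path.
have form_le (f : 'I_n -> R) : \sum_x f x = 0 ->
    dist_form (path_graph n) f <= mu * \sum_x f x ^+ 2.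
  move=> /sum0_ord_telescope[F [F0 Fn fF]].
  rewrite (_ : f = fun i : 'I_n => F i.+1 - F i); last exact/funext.
  by rewrite formE; exact: path_form_le.
have tele (F : nat -> R) m : \sum_(i < m) (F i.+1 - F i) = F m - F 0%N.
  by rewrite -(big_mkord xpredT (fun i => F i.+1 - F i)) telescope_sumr.
pose e (i : 'I_n) := E i.+1 - E i.
have e_neq0 : e (Ordinal (ltnW hn)) != 0.
  by rewrite /e /= E0 subr0 lt_eqF// path_ext1_lt0.
have QECE : QEC R (path_graph n) = mu%:E.
  apply: (QEC_finE _ _ _ _ e) => //.
  - by rewrite tele E0 En subrr.
  - by exists (Ordinal (ltnW hn)).
  - by rewrite formE; exact: path_form_ext.
have mu0 : mu < 0 by exact: path_mu_lt0.
have m_ge2 : (2 <= #|'I_n|)%N by rewrite card_ord.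
pose A := dist_mx R (path_graph n).
(* Taking the all-ones vector for [w] makes the hyperplane the functions of sum 0, where [form_le]
   applies. *)
have [le_mu eq_mu] : (spectrum A)`_1 <= mu /\
  ((spectrum A)`_1 = mu -> exists h : 'rV[R]__,
    [/\ h != 0, (h *m (const_mx 1 : 'cV_#|'I_n|)) 0 0 = 0 & h *m A = mu *: h]).
  apply: second_eigenvalue_le => //; first exact: dist_mx_sym.
  move=> h; rewrite sum_allones => /form_le.
  by rewrite dist_mx_form sum_sqE.
rewrite QECE /dist_eigenvalue /=; split=> // [n_even|n_odd].
  congr EFin; pose h : 'rV[R]_#|'I_n| := \row_i e (enum_val i).
  apply: (second_eigenvalue_eq _ _ _ _ h) => //.
  - exact: dist_mx_sym.
  - exact: dist_mx_trace.
  - apply: contra e_neq0 => /eqP/rowP/(_ (enum_rank (Ordinal (ltnW hn)))).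
    by rewrite !mxE enum_rankK => ->.
  apply/rowP => j; rewrite -(enum_valK j) dist_mxE !mxE enum_rankK /e.
  rewrite -path_ext_eigen//; apply: eq_bigr => x _.
  by rewrite mxE enum_rankK gdist_path mulrC addnC.
(* Equality would give a nonzero eigenvector of sum 0, whose primitive [F] vanishes by
   [path_eigen_odd]. *)
rewrite lte_fin lt_neqAle le_mu andbT; apply/eqP => /eq_mu[h [h0 + hA]].
rewrite sum_allones => /sum0_ord_telescope[F [F0 Fn hF]].
have Fz : forall k, (k <= n)%N -> F k = 0.
  apply: (path_eigen_odd R n) => // x.
  have := congr1 (fun M : 'rV_#|'I_n| => M 0 (enum_rank x)) hA.
  rewrite /= dist_mxE [RHS]mxE hF => <-; apply: eq_bigr => y _.
  by rewrite gdist_path hF mulrC addnC.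
move/eqP: h0; apply; apply/rowP => j.
by rewrite -(enum_valK j) hF !Fz ?subrr ?mxE// ltnW.
Qed.
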